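(* Under the standing assumptions below, there is a constant $C<\infty$ such that for all integers $1\le m<n$, $$b_mb_n\Big|P(S_m=\kappa_m,\,S_n=\kappa_n)-P(S_m=\kappa_m)P(S_n=\kappa_n)\Big|\le C\Big\{\Big(\frac{n}{n-m}\Big)^{1/\alpha}\frac{L(n)}{L(n-m)}+1\Big\}.$$
   Context: Standing assumptions: $(X_n)_{n\ge1}$ are i.i.d. real random variables whose common distribution $F$ is supported on a lattice $\{a+k:\ k\in\mathbb Z\}$ ($a\in\mathbb R$) with maximal span $1$; $S_n=X_1+\dots+X_n$. There exist $\alpha\in(0,2]$ with $\alpha\neq1$, constants $c_1,c_2\ge0$ with $c_1+c_2>0$, and a function $l$ slowly varying at infinity such that, as $x\to\infty$, $x^\alpha P(X_1>x)=(c_1+o(1))l(x)$ and $x^\alpha P(X_1\le -x)=(c_2+o(1))l(x)$. If $\alpha>1$, $E[X_1]=0$. Then $F$ is in the domain of attraction of an $\alpha$-stable law $G$: with $b_n=L(n)n^{1/\alpha}$, where $L$ is slowly varying, $S_n/b_n$ converges in distribution to $G$ (no centering constants needed). The characteristic function $\phi$ of $X_1$ satisfies, as $t\to0$, $\phi(t)=\exp\{-c|t|^\alpha h(1/|t|)(1-i\beta\,\mathrm{sign}(t)\tan\frac{\pi\alpha}{2})+o(|t|^\alpha h(1/|t|))\}$, where for $\alpha<2$: $h=l$, $c=\Gamma(1-\alpha)(c_1+c_2)\cos\frac{\pi\alpha}{2}>0$, $\beta=\frac{c_1-c_2}{c_1+c_2}$; and for $\alpha=2$: $c=1/2$, $\beta=0$,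 $h(x)=E[X_1^2\mathbf 1_{\{|X_1|\le x\}}]$. The function $h$ is slowly varying, determined up to asymptotic equivalence, and is chosen continuous on $[a_0,\infty)$ for some $a_0>0$; moreover $L(n)=h^{1/\alpha}(b_n)$ if $\alpha<2$ and $L(n)=\sqrt{h(b_n)}$ if $\alpha=2$. For each $n$, $\kappa_n$ is a point of the lattice $\{na+k:\ k\in\mathbb Z\}$ (where $S_n$ takes values), and $\kappa_n/b_n\to\kappa\in\mathbb R$ as $n\to\infty$. *)

(* Defs.v *)
From Stdlib Require Import Reals ZArith ClassicalEpsilon.
Open Scope R_scope.

(* Sum of a convergent real series (value chosen by classical epsilon;
   meaningful when the series converges, limits being unique). *)
Definition seriesR (u : nat -> R) : R :=
  epsilon (inhabits 0%R) (fun l => Un_cv (fun N => sum_f_R0 u N) l).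

Definition summableZ (f : Z -> R) : Prop :=
  (exists l, Un_cv (fun N => sum_f_R0 (fun n => f (Z.of_nat n)) N) l) /\
  (exists l, Un_cv (fun N => sum_f_R0 (fun n => f (- Z.of_nat (S n))%Z) N) l).

Definition sumZ (f : Z -> R) : R :=
  seriesR (fun n => f (Z.of_nat n)) + seriesR (fun n => f (- Z.of_nat (S n))%Z).

Definition conv (p q : Z -> R) (k : Z) : R := sumZ (fun j => p j * q (k - j)%Z).

(* n-fold convolution power: the law of S_n - n a when X_1 - a has mass function p. *)
Fixpoint convpow (p : Z -> R) (n : nat) : Z -> R :=
  match n with
  | O => fun k => if Z.eq_dec k 0 then 1 else 0
  | S n' => conv (convpow p n') p
  end.

(* The random walk: X_i = a + Y_i with Y_i i.i.d. of mass function p on Z.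
   P(S_n = n a + k) = probSn p n k. *)
Definition probSn (p : Z -> R) (n : nat) (k : Z) : R := convpow p n k.

(* P(S_m = m a + k1, S_n = n a + k2) for m <= n (independent increments). *)
Definition probJoint (p : Z -> R) (m n : nat) (k1 k2 : Z) : R :=
  convpow p m k1 * convpow p (n - m) (k2 - k1)%Z.

Definition tail_gt (p : Z -> R) (a x : R) : R :=
  sumZ (fun k => if Rlt_dec x (a + IZR k) then p k else 0).
Definition tail_le (p : Z -> R) (a x : R) : R :=
  sumZ (fun k => if Rle_dec (a + IZR k) (- x) then p k else 0).

Definition meanX (p : Z -> R) (a : R) : R := sumZ (fun k => (a + IZR k) * p k).
Definition trunc2 (p : Z -> R) (a x : R) : R :=
  sumZ (fun k => if Rle_dec (Rabs (a + IZR k)) x then (a + IZR k)^2 * p k else 0).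

Definition lim_infty (f : R -> R) (L : R) : Prop :=
  forall eps, eps > 0 -> exists M, forall x, x > M -> Rabs (f x - L) < eps.

Definition slowly_varying (l : R -> R) : Prop :=
  (exists M, forall x, x > M -> l x > 0) /\
  forall lam, lam > 0 -> lim_infty (fun x => l (lam * x) / l x) 1.

Definition maximal_span_one (p : Z -> R) : Prop :=
  forall d r : Z, (d > 1)%Z -> ~ (forall k, p k > 0 -> Z.modulo (k - r) d = 0%Z).

Definition Lfun (alpha : R) (b : nat -> R) (n : nat) : R :=
  b n / Rpower (INR n) (1 / alpha).

(* Main.v *)
(* The right-hand factor equals [b n / b (n - m) + 1], so the bound follows from the
   uniform local estimate sup_k P(S_n = k) <= C / b_n applied to S_m, S_(n-m) and S_n.
   For that estimate, Fourier inversion bounds P(S_n = k) by the mean of |phi|^n over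
   (0, pi), where |phi|^2 <= 1 - 2 p(j0) sum_i p(i) (1 - cos ((i - j0) t)) for any atom
   j0. Near 0 this gap is at least a multiple of t^2 E[X^2; |X| <= 1/(2t)], and away
   from 0 it is bounded below because the span is one. Monotonicity of the tails
   (alpha < 2) or of the truncated second moment (alpha = 2) gives an elementary
   Potter bound, hence n * gap >= c (b_n t)^theta and |phi|^n <= K / (1 + (b_n t)^2),
   whose integral is O(1 / b_n). All Fourier analysis is done for the restriction of p
   to finite sets that exhaust Z. *)

Require Import Defs.
From Stdlib Require Import Reals ZArith Lia Lra List FinFun ClassicalEpsilon.
From Coquelicot Require Import Coquelicot.
Open Scope R_scope.

(** * Finite sums and series over Z *)

(** Lists stand for finite subsets of Z. Repetitions count with multiplicity, so [NoDup] is required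
    wherever a sum must be read as a mass. *)
Definition lsum (f : Z -> R) (s : list Z) : R :=
  fold_right (fun i r => f i + r) 0 s.

Lemma lsum_cons f i s : lsum f (i :: s) = f i + lsum f s.
Proof. reflexivity. Qed.

Lemma lsum_ext f g s : (forall i, f i = g i) -> lsum f s = lsum g s.
Proof. intros H; induction s as [|i s IH]; simpl; [easy|]. now rewrite H, IH. Qed.

Lemma lsum_le f g s : (forall i, In i s -> f i <= g i) -> lsum f s <= lsum g s.
Proof.
  induction s as [|i s IH]; intros H; simpl; [lra|].
  apply Rplus_le_compat; [apply H; now left|].
  apply IH; intros j Hj; apply H; now right.
Qed.

Lemma lsum_nonneg f s : (forall i, 0 <= f i) -> 0 <= lsum f s.
Proof. intros H; induction s as [|i s IH]; simpl; [lra|]. specialize (H i); lra. Qed.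

Lemma lsum_plus f g s : lsum (fun i => f i + g i) s = lsum f s + lsum g s.
Proof. induction s as [|i s IH]; simpl; [lra|]. rewrite IH; lra. Qed.

Lemma lsum_scal c f s : lsum (fun i => c * f i) s = c * lsum f s.
Proof. induction s as [|i s IH]; simpl; [lra|]. rewrite IH; lra. Qed.

Lemma lsum_app f s1 s2 : lsum f (s1 ++ s2) = lsum f s1 + lsum f s2.
Proof. induction s1 as [|i s IH]; simpl; [lra|]. rewrite IH; lra. Qed.

Lemma lsum_map f g s : lsum f (map g s) = lsum (fun i => f (g i)) s.
Proof. induction s as [|i s IH]; simpl; [easy|]. now rewrite IH. Qed.

Lemma lsum_middle f s1 i s2 : lsum f (s1 ++ i :: s2) = f i + lsum f (s1 ++ s2).
Proof. rewrite !lsum_app, lsum_cons; lra. Qed.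

(** Each element of [s1] carrying a nonzero value is matched with one occurrence in [s2] and removed
    from it. Whatever is left over in [s2] only adds nonnegative terms. *)
Lemma lsum_support f s1 s2 :
  (forall i, 0 <= f i) -> NoDup s1 ->
  (forall i, In i s1 -> f i <> 0 -> In i s2) -> lsum f s1 <= lsum f s2.
Proof.
  intros Hf; revert s2; induction s1 as [|i s IH]; intros s2 Hnd Hin.
  { now apply lsum_nonneg. }
  inversion_clear Hnd as [|? ? Hi Hs].
  rewrite lsum_cons.
  destruct (Req_dec (f i) 0) as [H0|H0].
  { rewrite H0, Rplus_0_l; apply IH; [easy|]. intros j Hj; apply Hin; now right. }
  destruct (in_split i s2 (Hin i (or_introl eq_refl) H0)) as [u [v ->]].
  rewrite lsum_middle; apply Rplus_le_compat_l, IH; [easy|].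
  intros j Hj Hfj; generalize (Hin j (or_intror Hj) Hfj).
  rewrite !in_app_iff; simpl; intros [?|[->|?]]; tauto.
Qed.

Lemma lsum_ge_term f s i : (forall j, 0 <= f j) -> In i s -> f i <= lsum f s.
Proof.
  intros Hf Hi; destruct (in_split i s Hi) as [u [v ->]]; rewrite lsum_middle.
  pose proof (lsum_nonneg f (u ++ v) Hf); lra.
Qed.

(** The interval from -(M+1) to M, laid out like the two half-series of [sumZ], so that its sums are
    exactly the paired partial sums. *)
Definition Zrange (M : nat) : list Z :=
  map Z.of_nat (seq 0 (S M)) ++ map (fun n => (- Z.of_nat (S n))%Z) (seq 0 (S M)).

Lemma in_Zrange M i : (Z.abs i <= Z.of_nat M)%Z -> In i (Zrange M).
Proof.
  intros H; apply in_app_iff.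
  destruct (Z_le_gt_dec 0 i) as [Hi|Hi]; [left|right]; apply in_map_iff.
  - exists (Z.to_nat i); rewrite in_seq; lia.
  - exists (Z.to_nat (- i - 1)); rewrite in_seq; lia.
Qed.

Lemma NoDup_Zrange M : NoDup (Zrange M).
Proof.
  apply NoDup_app.
  - apply Injective_map_NoDup; [intros x y; lia|apply seq_NoDup].
  - apply Injective_map_NoDup; [intros x y; lia|apply seq_NoDup].
  - intros i H1 H2; apply in_map_iff in H1, H2.
    destruct H1 as [x [H1 _]], H2 as [y [H2 _]]; lia.
Qed.

Lemma incl_Zrange_mono M N : (M <= N)%nat -> incl (Zrange M) (Zrange N).
Proof.
  unfold Zrange; intros HMN i Hi; rewrite in_app_iff, !in_map_iff in *.
  destruct Hi as [[n [Hi Hn]]|[n [Hi Hn]]]; [left|right]; exists n;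
    rewrite in_seq in *; (split; [easy|lia]).
Qed.

Lemma incl_Zrange s : exists M, incl s (Zrange M).
Proof.
  induction s as [|i s [M IH]]; [now exists 0%nat|].
  exists (max M (Z.to_nat (Z.abs i))); intros j [<-|Hj].
  - apply in_Zrange; lia.
  - apply (incl_Zrange_mono M); [lia|now apply IH].
Qed.

Lemma sum_f_R0_lsum f (g : nat -> Z) N :
  sum_f_R0 (fun n => f (g n)) N = lsum f (map g (seq 0 (S N))).
Proof.
  induction N as [|N IH]; [simpl; lra|].
  rewrite tech5, IH, (seq_S (S N)), map_app, lsum_app; simpl; lra.
Qed.

(** Once some limit exists, [epsilon] returns a limit, and limits are unique. *)
Lemma seriesR_eq u l : Un_cv (fun N => sum_f_R0 u N) l -> seriesR u = l.
Proof.
  intros H; apply (UL_sequence (fun N => sum_f_R0 u N)); [|easy].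
  apply (epsilon_spec (inhabits 0) (fun l => Un_cv (fun N => sum_f_R0 u N) l)).
  now exists l.
Qed.

Lemma summableZ_cv f :
  summableZ f -> Un_cv (fun N => lsum f (Zrange N)) (sumZ f).
Proof.
  intros [[l1 H1] [l2 H2]]; unfold sumZ.
  rewrite (seriesR_eq _ _ H1), (seriesR_eq _ _ H2).
  apply Un_cv_ext with (2 := CV_plus _ _ _ _ H1 H2).
  intros N; unfold Zrange; rewrite lsum_app.
  now rewrite (sum_f_R0_lsum f Z.of_nat), (sum_f_R0_lsum f (fun n => (- Z.of_nat (S n))%Z)).
Qed.

Lemma lsum_le_sumZ f s :
  (forall i, 0 <= f i) -> summableZ f -> NoDup s -> lsum f s <= sumZ f.
Proof.
  intros Hf Hs Hnd; destruct (incl_Zrange s) as [M HM].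
  apply Rle_trans with (lsum f (Zrange M)).
  { apply lsum_support; [easy|easy|]. intros i Hi _; now apply HM. }
  apply (growing_ineq (fun N => lsum f (Zrange N))); [|now apply summableZ_cv].
  intros N; apply lsum_support; [easy|apply NoDup_Zrange|].
  intros i Hi _; apply (incl_Zrange_mono N); [lia|easy].
Qed.

Lemma sumZ_approx f eps : summableZ f -> 0 < eps ->
  exists s, NoDup s /\ sumZ f - eps < lsum f s.
Proof.
  intros Hs He; destruct (summableZ_cv f Hs eps He) as [N HN].
  exists (Zrange N); split; [apply NoDup_Zrange|].
  specialize (HN N (le_n N)); unfold Rdist in HN; apply Rabs_def2 in HN; lra.
Qed.

Lemma summableZ_bounded f B : (forall i, 0 <= f i) ->
  (forall s, NoDup s -> lsum f s <= B) -> summableZ f.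
Proof.
  intros Hf HB.
  assert (H : forall g : nat -> Z, (forall m n, g m = g n -> m = n) ->
      exists l, Un_cv (fun N => sum_f_R0 (fun n => f (g n)) N) l).
  { intros g Hg.
    destruct (growing_cv (fun N => sum_f_R0 (fun n => f (g n)) N)) as [l Hl].
    - intros N; rewrite tech5; specialize (Hf (g (S N))); lra.
    - exists B; intros x [N ->]; rewrite (sum_f_R0_lsum f g); apply HB.
      apply Injective_map_NoDup; [exact Hg|apply seq_NoDup].
    - now exists l. }
  split.
  - apply (H Z.of_nat); lia.
  - apply (H (fun n => (- Z.of_nat (S n))%Z)); lia.
Qed.

Lemma sumZ_bounded f B : (forall i, 0 <= f i) ->
  (forall s, NoDup s -> lsum f s <= B) -> sumZ f <= B.
Proof.
  intros Hf HB; apply le_epsilon; intros eps He.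
  destruct (sumZ_approx f eps (summableZ_bounded f B Hf HB) He) as [s [Hs Ha]].
  specialize (HB s Hs); lra.
Qed.

(** Both series are truncated at the same range. This serves bounds that control only the two sums
    together, as for the two-sided tail. *)
Lemma sumZ_plus_bounded f g B :
  (forall i, 0 <= f i) -> (forall i, 0 <= g i) -> summableZ f -> summableZ g ->
  (forall s, NoDup s -> lsum f s + lsum g s <= B) -> sumZ f + sumZ g <= B.
Proof.
  intros Hf Hg Sf Sg HB; apply le_epsilon; intros eps He.
  destruct (summableZ_cv f Sf (eps / 2) ltac:(lra)) as [N1 H1].
  destruct (summableZ_cv g Sg (eps / 2) ltac:(lra)) as [N2 H2].
  specialize (H1 (max N1 N2) ltac:(lia)); specialize (H2 (max N1 N2) ltac:(lia)).
  unfold Rdist in *; apply Rabs_def2 in H1, H2.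
  specialize (HB _ (NoDup_Zrange (max N1 N2))); lra.
Qed.

Lemma summableZ_le f g : (forall i, 0 <= f i <= g i) -> summableZ g -> summableZ f.
Proof.
  intros H Sg; apply summableZ_bounded with (sumZ g); [apply H|].
  intros s Hs; apply Rle_trans with (lsum g s).
  - apply lsum_le; intros; apply H.
  - apply lsum_le_sumZ; [|easy|easy]. intros i; specialize (H i); lra.
Qed.

Lemma sumZ_nonneg f : (forall i, 0 <= f i) -> summableZ f -> 0 <= sumZ f.
Proof. intros Hf Sf; exact (lsum_le_sumZ f nil Hf Sf (NoDup_nil Z)). Qed.

Lemma sumZ_le f g :
  (forall i, 0 <= f i <= g i) -> summableZ g -> sumZ f <= sumZ g.
Proof.
  intros H Sg; apply sumZ_bounded; [apply H|].
  intros s Hs; apply Rle_trans with (lsum g s).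
  - apply lsum_le; intros; apply H.
  - apply lsum_le_sumZ; [|easy|easy]. intros i; specialize (H i); lra.
Qed.

Lemma summableZ_scal c f : (forall i, 0 <= f i) -> 0 <= c -> summableZ f ->
  summableZ (fun i => c * f i).
Proof.
  intros Hf Hc Sf; apply summableZ_bounded with (c * sumZ f).
  - intros i; specialize (Hf i); nra.
  - intros s Hs; rewrite lsum_scal; apply Rmult_le_compat_l; [easy|].
    now apply lsum_le_sumZ.
Qed.

(** * Convolution powers *)

Definition is_pmf (p : Z -> R) : Prop :=
  (forall k, 0 <= p k) /\ summableZ p /\ sumZ p = 1.

Lemma lsum_pmf_le1 p s : is_pmf p -> NoDup s -> lsum p s <= 1.
Proof. intros [H0 [Hs <-]] Hnd; now apply lsum_le_sumZ. Qed.

Lemma lsum_pmf_reflect_le1 p k s :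
  is_pmf p -> NoDup s -> lsum (fun j => p (k - j)%Z) s <= 1.
Proof.
  intros Hp Hnd; rewrite <- (lsum_map p (fun j => (k - j)%Z)).
  apply lsum_pmf_le1; [easy|].
  apply Injective_map_NoDup; [intros x y; lia|easy].
Qed.

(** The terms are dominated by the reflected mass function j -> p(k - j), whose finite sums are at
    most 1. *)
Lemma conv_pmf_summable p f k : is_pmf p -> (forall j, 0 <= f j <= 1) ->
  (forall j, 0 <= f j * p (k - j)%Z) /\
  (forall s, NoDup s -> lsum (fun j => f j * p (k - j)%Z) s <= 1).
Proof.
  intros Hp Hf; assert (H0 := proj1 Hp); split.
  - intros j; specialize (Hf j); specialize (H0 (k - j)%Z); nra.
  - intros s Hs; eapply Rle_trans; [|exact (lsum_pmf_reflect_le1 p k s Hp Hs)].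
    apply lsum_le; intros j _; specialize (Hf j); specialize (H0 (k - j)%Z); nra.
Qed.

Lemma convpow_bounds p n k : is_pmf p -> 0 <= convpow p n k <= 1.
Proof.
  intros Hp; revert k; induction n as [|n IH]; intros k; simpl.
  { destruct (Z.eq_dec k 0); lra. }
  destruct (conv_pmf_summable p (convpow p n) k Hp IH) as [H1 H2].
  split; [|now apply sumZ_bounded].
  apply sumZ_nonneg; [easy|]. now apply summableZ_bounded with 1.
Qed.

(** Convolution power of the restriction of [p] to [s], without renormalising the lost mass. Every
    sum is finite, so it can be exchanged freely with integrals. *)
Fixpoint fpow (p : Z -> R) (s : list Z) (n : nat) (k : Z) : R :=
  match n with
  | O => if Z.eq_dec k 0 then 1 else 0
  | S n' => lsum (fun i => p i * fpow p s n' (k - i)%Z) s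
  end.

(** Union bound: each of the n steps leaves [s] with probability at most 1 - [lsum p s], and walks
    whose steps all stay in [s] are counted by [fpow]. *)
Lemma convpow_le_fpow p s n k : is_pmf p -> NoDup s ->
  convpow p n k <= fpow p s n k + INR n * (1 - lsum p s).
Proof.
  intros Hp Hs; revert k; induction n as [|n IH]; intros k; [simpl; lra|].
  assert (H0 := proj1 Hp).
  assert (Hf : forall j, 0 <= convpow p n j <= 1) by (intros j; now apply convpow_bounds).
  destruct (conv_pmf_summable p (convpow p n) k Hp Hf) as [H1 _].
  change (convpow p (S n) k) with (sumZ (fun j => convpow p n j * p (k - j)%Z)).
  apply sumZ_bounded; [easy|]; intros s1 Hs1.
  set (g := fun i => p i * convpow p n (k - i)%Z).
  rewrite (lsum_ext _ (fun j => g (k - j)%Z)).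
  2:{ intros j; unfold g; replace (k - (k - j))%Z with j by lia; lra. }
  (* Reindexing by the last step i = k - j lets the sum be split according to whether that step lies
     in [s]. *)
  rewrite <- (lsum_map g (fun j => (k - j)%Z)).
  set (s2 := map (fun j => (k - j)%Z) s1).
  assert (Hs2 : NoDup s2)
    by (apply Injective_map_NoDup; [intros x y; lia|easy]).
  set (r := filter (fun i => if in_dec Z.eq_dec i s then false else true) s2).
  assert (Hr : NoDup (s ++ r)).
  { apply NoDup_app; [easy|now apply NoDup_filter|].
    intros i Hi Hir; apply filter_In in Hir; destruct Hir as [_ Hir].
    now destruct (in_dec Z.eq_dec i s). }
  assert (Hg : forall i, 0 <= g i).
  { intros i; unfold g; specialize (Hf (k - i)%Z); specialize (H0 i); nra. }
  apply Rle_trans with (lsum g (s ++ r)).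
  { apply lsum_support; [easy|easy|]. intros i Hi _; apply in_app_iff.
    destruct (in_dec Z.eq_dec i s) as [Hin|Hin] eqn:E; [now left|right].
    apply filter_In; split; [easy|]; now rewrite E. }
  assert (Hle1 := lsum_pmf_le1 p _ Hp Hr).
  rewrite lsum_app in Hle1 |- *.
  assert (A1 : lsum g s <= fpow p s (S n) k + INR n * (1 - lsum p s) * lsum p s).
  { simpl fpow; rewrite <- lsum_scal, <- lsum_plus.
    apply lsum_le; intros i _; unfold g; specialize (IH (k - i)%Z); specialize (H0 i).
    nra. }
  (* Steps outside [s] contribute at most their own mass, which is bounded by 1 - [lsum p s]. *)
  assert (A2 : lsum g r <= lsum p r).
  { apply lsum_le; intros i _; unfold g; specialize (Hf (k - i)%Z); specialize (H0 i); nra. }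
  assert (A3 := lsum_pmf_le1 p s Hp Hs).
  assert (A4 := pos_INR n); rewrite S_INR.
  assert (A5 : 0 <= INR n * (1 - lsum p s)) by nra.
  nra.
Qed.

(** * Fourier inversion *)

Definition cos_sum (p : Z -> R) (s : list Z) (t : R) : R :=
  lsum (fun i => p i * cos (IZR i * t)) s.
Definition sin_sum (p : Z -> R) (s : list Z) (t : R) : R :=
  lsum (fun i => p i * sin (IZR i * t)) s.

(* Real and imaginary parts of the n-th power of the characteristic function
   of [p] restricted to [s]. *)
Fixpoint cf_pow (p : Z -> R) (s : list Z) (t : R) (n : nat) : R * R :=
  match n with
  | O => (1, 0)
  | S n' => let (x, y) := cf_pow p s t n' in
      (x * cos_sum p s t - y * sin_sum p s t, x * sin_sum p s t + y * cos_sum p s t)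
  end.

(** The real part of phi(t)^n e^(-ikt), where phi is the characteristic function of the restriction
    of [p] to [s]. *)
Definition inversion_integrand (p : Z -> R) s n k t : R :=
  fst (cf_pow p s t n) * cos (IZR k * t) + snd (cf_pow p s t n) * sin (IZR k * t).

Lemma inversion_integrand_S p s n k t :
  lsum (fun i => p i * inversion_integrand p s n (k - i) t) s =
  inversion_integrand p s (S n) k t.
Proof.
  unfold inversion_integrand; simpl.
  destruct (cf_pow p s t n) as [x y]; simpl.
  rewrite (lsum_ext _ (fun i =>
    (x * cos (IZR k * t) + y * sin (IZR k * t)) * (p i * cos (IZR i * t)) +
    (x * sin (IZR k * t) - y * cos (IZR k * t)) * (p i * sin (IZR i * t)))).
  - rewrite lsum_plus, !lsum_scal; unfold cos_sum, sin_sum; ring.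
  - intros i; rewrite minus_IZR, Rmult_minus_distr_r, cos_minus, sin_minus; ring.
Qed.

(** The real part of phi^n times a number of modulus 1 is at most |phi|^n in absolute value; both
    sides are kept squared to avoid roots. *)
Lemma inversion_integrand_sqr_le p s n k t :
  (inversion_integrand p s n k t) ^ 2 <= (cos_sum p s t ^ 2 + sin_sum p s t ^ 2) ^ n.
Proof.
  assert (H : forall m, fst (cf_pow p s t m) ^ 2 + snd (cf_pow p s t m) ^ 2 =
              (cos_sum p s t ^ 2 + sin_sum p s t ^ 2) ^ m).
  { induction m as [|m IH]; [simpl; ring|].
    rewrite <- (tech_pow_Rmult _ m), <- IH; simpl.
    destruct (cf_pow p s t m) as [x y]; simpl; ring. }
  rewrite <- H; unfold inversion_integrand.
  destruct (cf_pow p s t n) as [x y]; simpl fst; simpl snd.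
  assert (E := sin2_cos2 (IZR k * t)); unfold Rsqr in E.
  set (c := cos (IZR k * t)) in *; set (d := sin (IZR k * t)) in *.
  assert (0 <= (x * d - y * c) ^ 2) by apply pow2_ge_0.
  replace (x ^ 2 + y ^ 2) with ((x ^ 2 + y ^ 2) * (d * d + c * c)) by (rewrite E; ring).
  nra.
Qed.

Lemma is_RInt_lsum (c : Z -> R) (F : Z -> R -> R) (v : Z -> R) u w s :
  (forall i, is_RInt (F i) u w (v i)) ->
  is_RInt (fun t => lsum (fun i => c i * F i t) s) u w (lsum (fun i => c i * v i) s).
Proof.
  intros H; induction s as [|i s IH]; simpl.
  - generalize (is_RInt_const (V := R_NormedModule) u w 0).
    unfold scal; simpl; unfold mult; simpl; now rewrite Rmult_0_r.
  - apply (is_RInt_plus (V := R_NormedModule)); [|exact IH].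
    now apply (is_RInt_scal (V := R_NormedModule)).
Qed.

Lemma sin_IZR_PI k : sin (IZR k * PI) = 0.
Proof. apply sin_eq_0_1; now exists k. Qed.

Lemma is_RInt_cos_IZR k :
  is_RInt (fun t => cos (IZR k * t)) 0 PI (PI * (if Z.eq_dec k 0 then 1 else 0)).
Proof.
  destruct (Z.eq_dec k 0) as [->|Hk].
  - apply is_RInt_ext with (fun _ => 1).
    { intros t _; now rewrite Rmult_0_l, cos_0. }
    generalize (is_RInt_const (V := R_NormedModule) 0 PI 1).
    unfold scal; simpl; unfold mult; simpl; now rewrite Rminus_0_r.
  - assert (Hk' : IZR k <> 0) by now apply not_0_IZR.
    replace (PI * 0) with (minus (sin (IZR k * PI) / IZR k) (sin (IZR k * 0) / IZR k)).
    2:{ rewrite sin_IZR_PI, Rmult_0_r, sin_0; unfold minus, plus, opp; simpl; field; easy. }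
    apply (is_RInt_derive (fun t => sin (IZR k * t) / IZR k)).
    + intros t _; auto_derive; [easy|]. field; easy.
    + intros t _; apply (ex_derive_continuous (K := R_AbsRing) (V := R_NormedModule)); auto_derive; easy.
Qed.

(** The integrand is even in t, so half a period suffices. Both sides obey the same recursion in n,
    and n = 0 is the orthogonality of the cosines. *)
Lemma fpow_inversion p s n k :
  is_RInt (inversion_integrand p s n k) 0 PI (PI * fpow p s n k).
Proof.
  revert k; induction n as [|n IH]; intros k.
  - apply is_RInt_ext with (2 := is_RInt_cos_IZR k).
    intros t _; unfold inversion_integrand; simpl; ring.
  - apply is_RInt_ext with (fun t => lsum (fun i => p i * inversion_integrand p s n (k - i) t) s).
    { intros t _; apply inversion_integrand_S. }
    simpl fpow; rewrite <- lsum_scal.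
    rewrite (lsum_ext _ (fun i => p i * (PI * fpow p s n (k - i)%Z))) by (intros; ring).
    now apply is_RInt_lsum.
Qed.

(** The majorant has primitive K atan(B t) / B. Since atan is below pi, the factor pi of the
    inversion formula cancels. *)
Lemma fpow_le_of_lorentzian p s n k K B :
  0 < B -> 0 <= K ->
  (forall t, 0 < t < PI -> inversion_integrand p s n k t <= K * / (1 + (B * t)²)) ->
  fpow p s n k <= K / B.
Proof.
  intros HB HK H.
  assert (HPI := PI_RGT_0).
  assert (I : is_RInt (fun t => K * / (1 + (B * t)²)) 0 PI (K * (atan (B * PI) / B))).
  { replace (K * (atan (B * PI) / B)) with
      (minus (K * (atan (B * PI) / B)) (K * (atan (B * 0) / B))).
    2:{ rewrite Rmult_0_r, atan_0; unfold minus, plus, opp; simpl; field; lra. }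
    assert (D : forall t, 1 + (B * t)² <> 0)
      by (intros t; assert (Q := Rle_0_sqr (B * t)); lra).
    apply (is_RInt_derive (fun t => K * (atan (B * t) / B))).
    - intros t _; auto_derive; [easy|].
      assert (Q := D t); unfold Rsqr in *.
      field; split; [|lra]; contradict Q; rewrite <- Q; ring.
    - intros t _; apply (ex_derive_continuous (K := R_AbsRing) (V := R_NormedModule)).
      unfold Rsqr; auto_derive. apply D. }
  assert (L := is_RInt_le _ _ _ _ _ _ (Rlt_le _ _ HPI) (fpow_inversion p s n k) I H).
  assert (A := atan_bound (B * PI)).
  apply Rmult_le_reg_l with PI; [easy|].
  apply Rle_trans with (1 := L).
  replace (PI * (K / B)) with (K * (PI / B)) by (field; lra).
  apply Rmult_le_compat_l; [easy|].
  apply Rmult_le_compat_r; [left; now apply Rinv_0_lt_compat|lra].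
Qed.

(** The triangle inequality |phi| <= total mass, proved in squared form by adding one atom at a
    time. *)
Lemma cf_norm_le p s t : (forall i, 0 <= p i) ->
  cos_sum p s t ^ 2 + sin_sum p s t ^ 2 <= (lsum p s) ^ 2.
Proof.
  intros Hp; unfold cos_sum, sin_sum; induction s as [|i s IH]; simpl lsum; [lra|].
  set (x := lsum (fun i => p i * cos (IZR i * t)) s) in *.
  set (y := lsum (fun i => p i * sin (IZR i * t)) s) in *.
  assert (Hw := lsum_nonneg p s Hp); set (w := lsum p s) in *.
  assert (E := sin2_cos2 (IZR i * t)); unfold Rsqr in E.
  set (c := cos (IZR i * t)) in *; set (d := sin (IZR i * t)) in *.
  (* The projection of (x, y) on the unit vector (c, d) is no longer than (x, y) itself. *)
  assert (C1 : (x * c + y * d) ^ 2 <= w ^ 2).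
  { apply Rle_trans with (2 := IH).
    replace (x ^ 2 + y ^ 2) with ((x ^ 2 + y ^ 2) * (d * d + c * c)) by (rewrite E; ring).
    assert (0 <= (x * d - y * c) ^ 2) by apply pow2_ge_0; nra. }
  assert (C2 : x * c + y * d <= w) by (apply Rnot_lt_le; intros Hlt; nra).
  specialize (Hp i).
  replace ((p i * c + x) ^ 2 + (p i * d + y) ^ 2)
    with (p i ^ 2 * (d * d + c * c) + 2 * p i * (x * c + y * d) + (x ^ 2 + y ^ 2)) by ring.
  rewrite E; nra.
Qed.

(** The mass of [s] minus the real part of e^(-i j0 t) phi(t): rotating by the atom [j0] removes the
    phase of phi coming from that atom. *)
Definition cos_gap (p : Z -> R) (j0 : Z) (s : list Z) (t : R) : R :=
  lsum (fun i => p i * (1 - cos (IZR (i - j0) * t))) s.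

Lemma cos_gap_term_nonneg p j0 t i :
  (forall i, 0 <= p i) -> 0 <= p i * (1 - cos (IZR (i - j0) * t)).
Proof.
  intros Hp; apply Rmult_le_pos; [easy|].
  assert (B := COS_bound (IZR (i - j0) * t)); lra.
Qed.

(* Isolating the atom at j0, |p0 + w|^2 = p0^2 + 2 p0 Re w + |w|^2, and the gap
   measures how far Re w falls short of the remaining mass. *)
Lemma cf_norm_gap p s t j0 : is_pmf p -> NoDup s -> In j0 s ->
  cos_sum p s t ^ 2 + sin_sum p s t ^ 2 <= 1 - 2 * p j0 * cos_gap p j0 s t.
Proof.
  intros Hpm Hs Hj; assert (Hp := proj1 Hpm).
  assert (Hle := lsum_pmf_le1 p s Hpm Hs); assert (Hge := lsum_nonneg p s Hp).
  destruct (in_split j0 s Hj) as [u [v E]]; rewrite E in *; clear E.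
  assert (N := cf_norm_le p (u ++ v) t Hp).
  unfold cos_gap, cos_sum, sin_sum in *; rewrite !lsum_middle in *.
  set (r := u ++ v) in *.
  set (x := lsum (fun i => p i * cos (IZR i * t)) r) in *.
  set (y := lsum (fun i => p i * sin (IZR i * t)) r) in *.
  replace (j0 - j0)%Z with 0%Z by lia; rewrite Rmult_0_l, cos_0.
  assert (E : lsum (fun i => p i * (1 - cos (IZR (i - j0) * t))) r =
              lsum p r - (x * cos (IZR j0 * t) + y * sin (IZR j0 * t))).
  { rewrite (lsum_ext _ (fun i => p i + (- cos (IZR j0 * t) * (p i * cos (IZR i * t)) +
                                  - sin (IZR j0 * t) * (p i * sin (IZR i * t))))).
    - rewrite !lsum_plus, !lsum_scal; fold x y; ring.
    - intros i; rewrite minus_IZR, Rmult_minus_distr_r, cos_minus; ring. }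
  rewrite E.
  assert (T := sin2_cos2 (IZR j0 * t)); unfold Rsqr in T.
  set (c := cos (IZR j0 * t)) in *; set (d := sin (IZR j0 * t)) in *.
  replace ((p j0 * c + x) ^ 2 + (p j0 * d + y) ^ 2)
    with (p j0 ^ 2 * (d * d + c * c) + 2 * p j0 * (x * c + y * d) + (x ^ 2 + y ^ 2)) by ring.
  rewrite T; nra.
Qed.

(** From |phi|^2 <= 1 - 2g <= exp(-2g) one gets |phi|^(2n) <= exp(-ng)^2, and the squares are then
    compared. *)
Lemma inversion_integrand_le_exp p s n k t j0 : is_pmf p -> NoDup s -> In j0 s ->
  inversion_integrand p s n k t <= exp (- (INR n * (p j0 * cos_gap p j0 s t))).
Proof.
  intros Hpm Hs Hj.
  assert (H1 := inversion_integrand_sqr_le p s n k t).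
  assert (H2 := cf_norm_gap p s t j0 Hpm Hs Hj).
  set (g := p j0 * cos_gap p j0 s t) in *.
  apply Rnot_lt_le; intros Hlt.
  assert (H3 := exp_pos (- (INR n * g))).
  assert (H4 : (cos_sum p s t ^ 2 + sin_sum p s t ^ 2) ^ n <= exp (- (2 * g)) ^ n).
  { apply pow_incr; split.
    - assert (0 <= cos_sum p s t ^ 2) by apply pow2_ge_0.
      assert (0 <= sin_sum p s t ^ 2) by apply pow2_ge_0; lra.
    - assert (Q := exp_ineq1_le (- (2 * g))); unfold g in *; lra. }
  assert (H5 : exp (- (2 * g)) ^ n = exp (- (INR n * g)) ^ 2).
  { rewrite <- !Rpower_pow by apply exp_pos; unfold Rpower; rewrite !ln_exp.
    f_equal; simpl; ring. }
  nra.
Qed.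

(** * The gap away from zero *)

(** The condition cos u = 1 encodes membership of u in 2 pi Z; this and the next two lemmas give its
    closure under sums and integer multiples. *)
Lemma cos_eq_1_add u v : cos u = 1 -> cos v = 1 -> cos (u + v) = 1.
Proof.
  intros Hu Hv; rewrite cos_plus, Hu, Hv.
  assert (E := sin2_cos2 u); rewrite Hu in E; unfold Rsqr in E.
  assert (sin u = 0) by nra; nra.
Qed.

Lemma cos_eq_1_mul u n : cos u = 1 -> cos (INR n * u) = 1.
Proof.
  intros Hu; induction n as [|n IH]; [now rewrite Rmult_0_l, cos_0|].
  rewrite S_INR; replace ((INR n + 1) * u) with (INR n * u + u) by ring.
  now apply cos_eq_1_add.
Qed.

Lemma cos_eq_1_mulZ u z : cos u = 1 -> cos (IZR z * u) = 1.
Proof.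
  intros Hu; destruct (Z_le_gt_dec 0 z) as [Hz|Hz].
  - rewrite <- (Z2Nat.id z Hz), <- INR_IZR_INZ; now apply cos_eq_1_mul.
  - rewrite <- cos_neg; replace (- (IZR z * u)) with (IZR (- z) * u)
      by (rewrite opp_IZR; ring).
    rewrite <- (Z2Nat.id (- z)), <- INR_IZR_INZ by lia; now apply cos_eq_1_mul.
Qed.

Lemma cos_gap_incl p j0 s1 s2 t : (forall i, 0 <= p i) -> NoDup s1 -> incl s1 s2 ->
  cos_gap p j0 s1 t <= cos_gap p j0 s2 t.
Proof.
  intros Hp Hs Hi; apply lsum_support; [|easy|].
  - intros i; now apply cos_gap_term_nonneg.
  - intros i Hin _; now apply Hi.
Qed.

Lemma cos_gap_zero p j0 M k t : (forall i, 0 <= p i) ->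
  cos_gap p j0 (Zrange M) t <= 0 -> (Z.abs k <= Z.of_nat M)%Z -> 0 < p k ->
  cos (IZR (k - j0) * t) = 1.
Proof.
  intros Hp H0 Hk Hpk.
  assert (H := lsum_ge_term _ _ k (fun i => cos_gap_term_nonneg p j0 t i Hp) (in_Zrange M k Hk)).
  fold (cos_gap p j0 (Zrange M) t) in H.
  assert (B := COS_bound (IZR (k - j0) * t)); nra.
Qed.

(** If [j0] were the only atom, all the mass would lie in one residue class modulo 2. *)
Lemma exists_other_atom p j0 : maximal_span_one p -> exists k, 0 < p k /\ k <> j0.
Proof.
  intros Hspan; apply NNPP; intros Hno.
  apply (Hspan 2%Z j0 ltac:(lia)); intros k Hk.
  destruct (Z.eq_dec k j0) as [->|Hne]; [now rewrite Z.sub_diag|].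
  exfalso; apply Hno; now exists k.
Qed.

(* The positive integers g such that every zero t of some finite gap satisfies
   g t in 2 pi Z: Euclidean division shows that the least one divides every k - j0. *)
Lemma cos_gap_zero_trivial p j0 : (forall i, 0 <= p i) -> maximal_span_one p -> 0 < p j0 ->
  exists M, forall t, cos_gap p j0 (Zrange M) t <= 0 -> cos t = 1.
Proof.
  intros Hp Hspan Hj.
  set (Q := fun g : nat => (0 < g)%nat /\
     exists M, forall t, cos_gap p j0 (Zrange M) t <= 0 -> cos (IZR (Z.of_nat g) * t) = 1).
  assert (Hex : exists g, Q g).
  { destruct (exists_other_atom p j0 Hspan) as [k [Hk Hne]].
    exists (Z.to_nat (Z.abs (k - j0))); split; [lia|].
    exists (Z.to_nat (Z.abs k)); intros t Ht.
    assert (E : cos (IZR (k - j0) * t) = 1)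
      by (apply (cos_gap_zero p j0 _ k t Hp Ht); [lia|easy]).
    rewrite Z2Nat.id by lia.
    destruct (Z.abs_eq_or_opp (k - j0)) as [-> | ->]; [easy|].
    rewrite opp_IZR, Ropp_mult_distr_l_reverse, cos_neg; easy. }
  destruct (dec_inh_nat_subset_has_unique_least_element Q (fun n => classic (Q n)) Hex)
    as [g [[[Hg [M HM]] Hmin] _]].
  assert (Hdiv : forall k, p k > 0 -> Z.modulo (k - j0) (Z.of_nat g) = 0%Z).
  { intros k Hk.
    assert (Hb := Z.mod_pos_bound (k - j0) (Z.of_nat g) ltac:(lia)).
    destruct (Z.eq_dec ((k - j0) mod Z.of_nat g) 0) as [?|Hne]; [easy|exfalso].
    set (r := ((k - j0) mod Z.of_nat g)%Z) in *.
    (* The remainder is an integer combination of k - j0 and g. After enlarging the range to contain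
       k, it inherits the property [Q], against the minimality of g. *)
    assert (Qr : Q (Z.to_nat r)).
    { split; [lia|]; exists (max M (Z.to_nat (Z.abs k))); intros t Ht.
      assert (E1 : cos (IZR (k - j0) * t) = 1)
        by (apply (cos_gap_zero p j0 _ k t Hp Ht); [lia|easy]).
      assert (E2 : cos (IZR (Z.of_nat g) * t) = 1).
      { apply HM; apply Rle_trans with (2 := Ht); apply cos_gap_incl; [easy|apply NoDup_Zrange|].
        apply incl_Zrange_mono; lia. }
      rewrite Z2Nat.id by lia.
      assert (Er : r = (k - j0 + - ((k - j0) / Z.of_nat g) * Z.of_nat g)%Z)
        by (unfold r; rewrite Z.mod_eq by lia; lia).
      rewrite Er, plus_IZR, mult_IZR, Rmult_plus_distr_r, Rmult_assoc.
      apply cos_eq_1_add; [easy|]. now apply cos_eq_1_mulZ. }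
    specialize (Hmin _ Qr); lia. }
  assert (Hg1 : g = 1%nat).
  { destruct (Nat.eq_dec g 1) as [?|Hne]; [easy|exfalso].
    apply (Hspan (Z.of_nat g) j0); [lia|easy]. }
  exists M; intros t Ht; specialize (HM t Ht); subst g.
  now rewrite Rmult_1_l in HM.
Qed.

Lemma continuity_cos_gap p j0 s t : continuity_pt (cos_gap p j0 s) t.
Proof.
  apply continuity_pt_filterlim; change (continuous (cos_gap p j0 s) t).
  unfold cos_gap; induction s as [|i s IH]; simpl lsum.
  - apply continuous_const.
  - apply (continuous_plus (V := R_NormedModule)
      (fun t => p i * (1 - cos (IZR (i - j0) * t)))); [|exact IH].
    apply (ex_derive_continuous (K := R_AbsRing) (V := R_NormedModule)); auto_derive; easy.
Qed.

(** By compactness the gap attains its minimum on [delta, pi]. A minimum that is not positive would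
    force cos t0 = 1, while cos is strictly decreasing on [0, pi]. *)
Lemma cos_gap_away_from_zero p j0 delta :
  (forall i, 0 <= p i) -> maximal_span_one p -> 0 < p j0 -> 0 < delta <= PI ->
  exists M eta, 0 < eta /\ forall t, delta <= t <= PI -> eta <= cos_gap p j0 (Zrange M) t.
Proof.
  intros Hp Hspan Hj Hd.
  destruct (cos_gap_zero_trivial p j0 Hp Hspan Hj) as [M HM].
  destruct (continuity_ab_min (cos_gap p j0 (Zrange M)) delta PI) as [t0 [Hmin Ht0]];
    [lra|intros; apply continuity_cos_gap|].
  exists M, (cos_gap p j0 (Zrange M) t0); split; [|easy].
  apply Rnot_le_lt; intros Hle; specialize (HM t0 Hle).
  assert (H := cos_decreasing_1 0 t0).
  assert (HPI := PI_RGT_0); rewrite cos_0 in H; lra.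
Qed.

(** * The gap near zero *)

(** Taylor: cos u <= 1 - u^2/2 + u^4/24, and u^4 <= u^2 here. *)
Lemma one_minus_cos_ge u : Rabs u <= 1 -> u ^ 2 / 4 <= 1 - cos u.
Proof.
  intros Hu; apply Rabs_le_between in Hu.
  destruct (pre_cos_bound u 0 ltac:(lra) ltac:(lra)) as [_ H].
  unfold cos_approx, cos_term in H; simpl in H.
  assert (0 <= u ^ 2 <= 1) by (simpl; nra).
  assert (u ^ 2 * u ^ 2 <= u ^ 2) by nra.
  simpl in *; lra.
Qed.

Lemma trunc2_term_bounds p a x k : (forall i, 0 <= p i) ->
  0 <= (if Rle_dec (Rabs (a + IZR k)) x then (a + IZR k) ^ 2 * p k else 0) <= x ^ 2 * p k.
Proof.
  intros Hp; specialize (Hp k).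
  assert (0 <= (a + IZR k) ^ 2) by apply pow2_ge_0.
  assert (0 <= x ^ 2) by apply pow2_ge_0.
  destruct (Rle_dec (Rabs (a + IZR k)) x) as [Hk|Hk]; [|nra].
  apply Rabs_le_between in Hk; split; [nra|].
  apply Rmult_le_compat_r; [easy|nra].
Qed.

Lemma trunc2_summable p a x : is_pmf p -> summableZ
  (fun k => if Rle_dec (Rabs (a + IZR k)) x then (a + IZR k) ^ 2 * p k else 0).
Proof.
  intros [Hp [Hs _]]; apply summableZ_le with (fun k => x ^ 2 * p k).
  - intros k; now apply trunc2_term_bounds.
  - apply summableZ_scal; [easy|apply pow2_ge_0|easy].
Qed.

(* The additive error coming from the shift between [a + k] and [k - j0] is
   absorbed by an atom k1 <> j0. *)
Lemma cos_gap_ge_trunc2 p a j0 : is_pmf p -> maximal_span_one p ->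
  exists c X, 0 < c /\ 0 < X /\ forall s t, 0 < t -> X <= / t ->
    (forall k, Rabs (IZR (k - j0)) <= / t -> In k s) ->
    c * t ^ 2 * trunc2 p a (/ t / 2) <= cos_gap p j0 s t.
Proof.
  intros Hpm Hspan; assert (Hp := proj1 Hpm).
  destruct (exists_other_atom p j0 Hspan) as [k1 [Hk1 Hne]].
  set (d := a + IZR j0).
  (* Chosen so that 2S + 2d^2 <= A S as soon as S >= p(k1). *)
  set (A := 2 + 2 * d ^ 2 / p k1).
  assert (Hd := pow2_ge_0 d).
  assert (HA : 2 <= A).
  { unfold A; assert (0 <= 2 * d ^ 2 / p k1)
      by (apply Rmult_le_pos; [lra|left; now apply Rinv_0_lt_compat]); lra. }
  (* The first bound makes |a + k| <= x/2 imply |k - j0| <= x; the second puts [k1] in the window |k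
     - j0| <= x. *)
  exists (/ (4 * A)), (Rmax (2 * Rabs d + 1) (Rabs (IZR (k1 - j0)))).
  split; [apply Rinv_0_lt_compat; lra|].
  split. { eapply Rlt_le_trans; [|apply Rmax_l]. assert (Q := Rabs_pos d); lra. }
  intros s t Ht HX Hin.
  assert (X1 := Rle_trans _ _ _ (Rmax_l _ _) HX).
  assert (X2 := Rle_trans _ _ _ (Rmax_r _ _) HX); clear HX.
  set (x := / t) in *.
  assert (Htx : t * x = 1) by (unfold x; field; lra).
  set (v := fun k => if Rle_dec (Rabs (IZR (k - j0))) x then IZR (k - j0) ^ 2 * p k else 0).
  assert (Hv : forall k, 0 <= v k).
  { intros k; unfold v; destruct (Rle_dec (Rabs (IZR (k - j0))) x); [|lra].
    apply Rmult_le_pos; [apply pow2_ge_0|easy]. }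
  assert (G : t ^ 2 / 4 * lsum v s <= cos_gap p j0 s t).
  { rewrite <- lsum_scal; apply lsum_le; intros k _.
    assert (G0 := cos_gap_term_nonneg p j0 t k Hp).
    unfold v; destruct (Rle_dec (Rabs (IZR (k - j0))) x) as [Hk|Hk]; [|lra].
    assert (B := one_minus_cos_ge (IZR (k - j0) * t)).
    rewrite Rabs_mult, (Rabs_pos_eq t) in B by lra.
    assert (Rabs (IZR (k - j0)) * t <= 1) by nra.
    specialize (B H); rewrite Rpow_mult_distr in B; specialize (Hp k); nra. }
  assert (L1 : p k1 <= lsum v s).
  { apply Rle_trans with (v k1).
    - unfold v; destruct (Rle_dec (Rabs (IZR (k1 - j0))) x) as [_|H]; [|easy].
      assert (Q : 1 <= IZR (k1 - j0) ^ 2).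
      { rewrite pow_IZR; apply IZR_le; nia. }
      nra.
    - apply lsum_ge_term; [easy|]. now apply Hin. }
  assert (L2 : trunc2 p a (x / 2) <= 2 * lsum v s + 2 * d ^ 2).
  { apply sumZ_bounded; [intros k; now apply trunc2_term_bounds|].
    intros s1 Hs1.
    apply Rle_trans with (2 * lsum v s1 + 2 * d ^ 2 * lsum p s1).
    - rewrite <- !lsum_scal, <- lsum_plus; apply lsum_le; intros k _.
      assert (V := Hv k); unfold v in *.
      assert (E : a + IZR k = IZR (k - j0) + d) by (unfold d; rewrite minus_IZR; ring).
      rewrite E; set (z := IZR (k - j0)) in *.
      specialize (Hp k).
      destruct (Rle_dec (Rabs (z + d)) (x / 2)) as [H1|H1]; [|nra].
      destruct (Rle_dec (Rabs z) x) as [H2|H2].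
      + assert (0 <= (z - d) ^ 2) by apply pow2_ge_0; nra.
      + exfalso; apply H2.
        replace z with ((z + d) + - d) by ring.
        eapply Rle_trans; [apply Rabs_triang|]; rewrite Rabs_Ropp; lra.
    - assert (M := lsum_pmf_le1 p s1 Hpm Hs1).
      assert (lsum v s1 <= lsum v s).
      { apply lsum_support; [easy|easy|]. intros k _ Hk; apply Hin.
        unfold v in Hk; now destruct (Rle_dec (Rabs (IZR (k - j0))) x). }
      nra. }
  assert (L3 : trunc2 p a (x / 2) <= A * lsum v s).
  { apply Rle_trans with (1 := L2); unfold A; rewrite Rmult_plus_distr_r.
    apply Rplus_le_compat_l.
    replace (2 * d ^ 2) with (2 * d ^ 2 / p k1 * p k1) at 1 by (field; lra).
    apply Rmult_le_compat_l; [|easy].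
    apply Rmult_le_pos; [lra|left; now apply Rinv_0_lt_compat]. }
  apply Rle_trans with (2 := G).
  replace (t ^ 2 / 4 * lsum v s) with (/ (4 * A) * t ^ 2 * (A * lsum v s)) by (field; lra).
  apply Rmult_le_compat_l; [|easy].
  apply Rmult_le_pos; [left; apply Rinv_0_lt_compat; lra|apply pow2_ge_0].
Qed.

(** * Potter-type decay and stretched exponentials *)

Lemma Rpower_pos x y : 0 < Rpower x y.
Proof. apply exp_pos. Qed.

(** A Potter bound: the halving inequality is iterated along x, 2x, 4x, ... until y is within a
    factor 2, and that last stretch costs the constant K 2^th. *)
Lemma doubling_decay (U : R -> R) x0 K th :
  0 < x0 -> 0 < th -> 0 <= K ->
  (forall x, x0 <= x -> 0 <= U x) ->
  (forall x, x0 <= x -> Rpower 2 th * U (2 * x) <= U x) ->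
  (forall x z, x0 <= x <= z -> z <= 2 * x -> U z <= K * U x) ->
  forall x y, x0 <= x <= y -> Rpower (y / x) th * U y <= K * Rpower 2 th * U x.
Proof.
  intros Hx0 Hth HK HU Hd Hm.
  assert (H : forall k x y, x0 <= x <= y -> y <= 2 ^ k * x ->
     Rpower (y / x) th * U y <= K * Rpower 2 th * U x).
  { assert (B : forall x y, x0 <= x <= y -> y <= 2 * x ->
       Rpower (y / x) th * U y <= K * Rpower 2 th * U x).
    { intros x y Hxy Hy.
      assert (R1 : Rpower (y / x) th <= Rpower 2 th).
      { apply Rle_Rpower_l; [lra|split].
        - apply Rdiv_lt_0_compat; lra.
        - apply Rle_div_l; lra. }
      assert (R2 := Rpower_pos (y / x) th).
      specialize (Hm x y Hxy Hy); assert (U1 := HU x ltac:(lra)); assert (U2 := HU y ltac:(lra)).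
      apply Rle_trans with (Rpower 2 th * (K * U x)); [|right; ring].
      apply Rmult_le_compat; lra. }
    induction k as [|k IH]; intros x y Hxy Hy.
    { apply B; [easy|]. simpl in Hy; lra. }
    destruct (Rle_lt_dec y (2 * x)) as [H2|H2]; [now apply B|].
    assert (I := IH (2 * x) y ltac:(lra) ltac:(simpl in Hy; lra)).
    assert (E : Rpower (y / x) th = Rpower 2 th * Rpower (y / (2 * x)) th).
    { rewrite Rpower_mult_distr; [|lra|apply Rdiv_lt_0_compat; lra].
      f_equal; field; lra. }
    assert (D := Hd x ltac:(lra)).
    rewrite E, Rmult_assoc.
    apply Rle_trans with (Rpower 2 th * (K * Rpower 2 th * U (2 * x))).
    - apply Rmult_le_compat_l; [left; apply Rpower_pos|easy].
    - replace (Rpower 2 th * (K * Rpower 2 th * U (2 * x)))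
        with (K * Rpower 2 th * (Rpower 2 th * U (2 * x))) by ring.
      apply Rmult_le_compat_l; [|easy].
      apply Rmult_le_pos; [easy|left; apply Rpower_pos]. }
  intros x y Hxy.
  destruct (Pow_x_infinity 2 ltac:(rewrite Rabs_pos_eq; lra) (y / x)) as [k Hk].
  specialize (Hk k (le_n k)); rewrite Rabs_pos_eq in Hk by (apply pow_le; lra).
  apply (H k); [easy|]. apply Rge_le, Rle_div_l in Hk; lra.
Qed.

Lemma exp_le x y : x <= y -> exp x <= exp y.
Proof. intros [H| ->]; [left; now apply exp_increasing|lra]. Qed.

(** With m th > 2, the bound exp w >= w at w = (c/m) u^th, raised to the power m, gives exp(c u^th)
    >= (c/m)^m u^2. *)
Lemma stretched_exp_le c th : 0 < c -> 0 < th ->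
  exists K, 2 <= K /\
    forall u, 1 <= u -> exp (- (c * Rpower u th)) <= K * / (1 + u²).
Proof.
  intros Hc Hth.
  destruct (INR_archimed th 2 ltac:(lra)) as [m Hm].
  assert (Hm0 : 0 < INR m).
  { destruct m; [simpl in Hm; lra|]. apply lt_0_INR; lia. }
  set (q := (c / INR m) ^ m).
  assert (Hq : 0 < q) by (apply pow_lt, Rdiv_lt_0_compat; easy).
  (* The part 2/q suffices for u >= 1, as 1 + u^2 <= 2 u^2. The summand 2 ensures K / (1 + u^2) >= 1
     for 0 <= u <= 1, which is used when b_n t < 1. *)
  exists (2 + 2 / q); split.
  { assert (0 < 2 / q) by (apply Rdiv_lt_0_compat; lra); lra. }
  intros u Hu.
  assert (E1 : q * u² <= exp (c * Rpower u th)).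
  { apply Rle_trans with ((c / INR m * Rpower u th) ^ m).
    - rewrite Rpow_mult_distr; apply Rmult_le_compat_l; [left; exact Hq|].
      rewrite <- (Rpower_pow m) by apply Rpower_pos.
      rewrite Rpower_mult.
      replace (u²) with (Rpower u 2).
      + apply Rle_Rpower; [easy|lra].
      + replace 2 with (INR 2) by (simpl; ring).
        rewrite Rpower_pow by lra; unfold Rsqr; ring.
    - replace (c * Rpower u th) with (INR m * (c / INR m * Rpower u th)) at 1
        by (field; lra).
      set (w := c / INR m * Rpower u th).
      assert (Hw : 0 < w) by (apply Rmult_lt_0_compat; [now apply Rdiv_lt_0_compat|apply Rpower_pos]).
      replace (exp (INR m * w)) with (exp w ^ m).
      + apply pow_incr; split; [lra|]. assert (Q := exp_ineq1_le w); lra.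
      + rewrite <- Rpower_pow by apply exp_pos; unfold Rpower; now rewrite ln_exp. }
  assert (Hu2 : 1 <= u²) by (unfold Rsqr; nra).
  rewrite exp_Ropp.
  apply Rle_trans with (/ (q * u²)).
  { apply Rinv_le_contravar; [nra|easy]. }
  apply Rmult_le_reg_r with (q * u² * (1 + u²)); [nra|].
  replace (/ (q * u²) * (q * u² * (1 + u²))) with (1 + u²) by (field; lra).
  replace ((2 + 2 / q) * / (1 + u²) * (q * u² * (1 + u²)))
    with (2 * q * u² + 2 * u²) by (field; lra).
  nra.
Qed.

(* Instantiated with the two-sided tail if alpha < 2, and with [trunc2 / x ^ 2] if alpha = 2. *)
Definition decay_profile (p : Z -> R) (a : R) (U : R -> R) (x0 K th c : R) : Prop :=
  0 < x0 /\ 0 < th /\ 0 < K /\ 0 < c /\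
  (forall x, x0 <= x -> 0 <= U x) /\
  (forall x, x0 <= x -> Rpower 2 th * U (2 * x) <= U x) /\
  (forall x z, x0 <= x <= z -> z <= 2 * x -> U z <= K * U x) /\
  (forall x, x0 <= x -> c * x ^ 2 * U x <= trunc2 p a x).

(** For t away from 0 the gap is at least a constant, and the growth of n absorbs (b_n t)^th. For
    small t the gap at t is compared with U(1/(2t)), and the Potter bound compares this with U(b_n).
    The constant c' is uniform in n; only the range M depends on n. *)
Lemma cos_gap_growth p a (b : nat -> R) (U : R -> R) x0 K th c j0 :
  is_pmf p -> maximal_span_one p -> 0 < p j0 ->
  decay_profile p a U x0 K th c ->
  exists c', 0 < c' /\ forall n, x0 <= b n -> c <= INR n * U (b n) ->
    exists M, forall s t, incl (Zrange M) s -> 1 <= b n * t -> 0 < t <= PI ->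
      c' * Rpower (b n * t) th <= INR n * (p j0 * cos_gap p j0 s t).
Proof.
  intros Hpm Hspan Hj [Hx0 [Hth [HK [Hc [HU [Hd [Hm HUV]]]]]]].
  assert (Hp := proj1 Hpm); assert (HPI := PI_RGT_0).
  destruct (cos_gap_ge_trunc2 p a j0 Hpm Hspan) as [c2 [X [Hc2 [HX Hgap]]]].
  (* For t < delta this gives 1/t >= X and y = 1/(2t) >= x0, so both the second-moment bound and the
     Potter bound apply. *)
  set (Y := Rmax X (2 * x0)).
  assert (HY : X <= Y /\ 2 * x0 <= Y) by (split; [apply Rmax_l|apply Rmax_r]).
  set (delta := Rmin PI (/ Y)).
  assert (Hdelta : 0 < delta <= PI /\ delta <= / Y).
  { split; [split|]; [|apply Rmin_l|apply Rmin_r].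
    apply Rmin_glb_lt; [easy|apply Rinv_0_lt_compat; lra]. }
  destruct (cos_gap_away_from_zero p j0 delta Hp Hspan Hj (proj1 Hdelta)) as [M [eta [Heta Haway]]].
  assert (Hdecay := doubling_decay U x0 K th Hx0 Hth (Rlt_le _ _ HK) HU Hd Hm).
  set (K2 := K * Rpower 2 th) in *.
  assert (HK2 : 0 < K2) by (apply Rmult_lt_0_compat; [easy|apply Rpower_pos]).
  (* Makes (b_n t)^th <= n A for all t <= pi, by the Potter bound between x0 and b_n; the 1 keeps it
     positive. *)
  set (A := K2 * U x0 * Rpower (x0 * PI) th / c + 1).
  assert (HA : 0 < A).
  { assert (0 <= K2 * U x0 * Rpower (x0 * PI) th / c).
    { assert (U0 := HU x0 (Rle_refl x0)).
      apply Rmult_le_pos; [|left; now apply Rinv_0_lt_compat].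
      apply Rmult_le_pos; [nra|left; apply Rpower_pos]. }
    unfold A; lra. }
  set (e1 := p j0 * eta / A); set (e2 := p j0 * c2 * c * c / (4 * K2)).
  assert (He1 : 0 < e1) by (apply Rdiv_lt_0_compat; [nra|easy]).
  assert (He2 : 0 < e2)
    by (apply Rdiv_lt_0_compat; [repeat apply Rmult_lt_0_compat; easy|lra]).
  exists (Rmin e1 e2); split; [now apply Rmin_glb_lt|].
  intros n Hbn HnU.
  set (B := b n) in *.
  assert (Hn0 := pos_INR n).
  assert (Hy : forall y, x0 <= y <= B -> c * Rpower (B / y) th <= INR n * (K2 * U y)).
  { intros y Hy.
    assert (Q := Hdecay y B Hy).
    assert (R1 := Rpower_pos (B / y) th).
    apply Rle_trans with (INR n * (Rpower (B / y) th * U B)); [nra|].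
    now apply Rmult_le_compat_l. }
  (* Since 1/t <= b_n, this range contains every k with |k - j0| <= 1/t. *)
  exists (max M (Z.to_nat (Z.abs j0 + up B))).
  intros s t Hs Ht1 Ht.
  assert (Hbt : 0 < B * t) by lra.
  assert (R0 := Rpower_pos (B * t) th).
  destruct (Rle_lt_dec delta t) as [Hlarge|Hsmall].
  - apply Rle_trans with (e1 * Rpower (B * t) th).
    { apply Rmult_le_compat_r; [lra|apply Rmin_l]. }
    assert (G : eta <= cos_gap p j0 s t).
    { apply Rle_trans with (1 := Haway t ltac:(lra)).
      apply cos_gap_incl; [easy|apply NoDup_Zrange|].
      intros i Hi; apply Hs, (incl_Zrange_mono M); [lia|easy]. }
    assert (P : Rpower (B * t) th <= INR n * A).
    { apply Rle_trans with (Rpower (B / x0 * (x0 * PI)) th).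
      - apply Rle_Rpower_l; [lra|split; [easy|]].
        replace (B / x0 * (x0 * PI)) with (B * PI) by (field; lra).
        apply Rmult_le_compat_l; lra.
      - rewrite <- Rpower_mult_distr; [|apply Rdiv_lt_0_compat; lra|nra].
        assert (Q := Hy x0 ltac:(lra)).
        assert (R2 := Rpower_pos (x0 * PI) th).
        apply Rle_trans with (INR n * (K2 * U x0) / c * Rpower (x0 * PI) th).
        + apply Rmult_le_compat_r; [lra|]. apply Rle_div_r; [lra|]. lra.
        + unfold A; rewrite Rmult_plus_distr_l, Rmult_1_r.
          replace (INR n * (K2 * U x0) / c * Rpower (x0 * PI) th)
            with (INR n * (K2 * U x0 * Rpower (x0 * PI) th / c)) by (field; lra).
          lra. }
    apply Rle_trans with (e1 * (INR n * A)); [apply Rmult_le_compat_l; lra|].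
    replace (e1 * (INR n * A)) with (INR n * (p j0 * eta)) by (unfold e1; field; lra).
    apply Rmult_le_compat_l; [easy|]. apply Rmult_le_compat_l; lra.
  - apply Rle_trans with (e2 * Rpower (B * t) th).
    { apply Rmult_le_compat_r; [lra|apply Rmin_r]. }
    assert (HtY : Y <= / t).
    { rewrite <- (Rinv_inv Y); apply Rinv_le_contravar; lra. }
    assert (HtB : / t <= B).
    { apply Rmult_le_reg_r with t; [easy|]. rewrite Rinv_l; lra. }
    set (y := / t / 2).
    assert (Hyr : x0 <= y <= B) by (unfold y; lra).
    assert (G := Hgap s t (proj1 Ht) ltac:(lra)).
    assert (Hin : forall k, Rabs (IZR (k - j0)) <= / t -> In k s).
    { intros k Hk; apply Hs, in_Zrange.
      assert (Hup := proj1 (archimed B)).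
      assert (Z1 : (Z.abs (k - j0) <= up B)%Z).
      { apply le_IZR; rewrite abs_IZR; lra. }
      lia. }
    specialize (G Hin); fold y in G.
    assert (V := HUV y (proj1 Hyr)).
    assert (Q := Hy y Hyr).
    assert (R3 : Rpower (B * t) th <= Rpower (B / y) th).
    { apply Rle_Rpower_l; [lra|split; [easy|]].
      replace (B / y) with (2 * (B * t)) by (unfold y; field; lra); lra. }
    assert (G2 : c2 * c / 4 * U y <= cos_gap p j0 s t).
    { apply Rle_trans with (2 := G).
      replace (c2 * c / 4 * U y) with (c2 * t ^ 2 * (c * y ^ 2 * U y))
        by (unfold y; field; lra).
      apply Rmult_le_compat_l; [|easy].
      apply Rmult_le_pos; [lra|apply pow2_ge_0]. }
    apply Rle_trans with (INR n * (p j0 * (c2 * c / 4 * U y))).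
    + replace (INR n * (p j0 * (c2 * c / 4 * U y)))
        with (p j0 * c2 * c / (4 * K2) * (INR n * (K2 * U y))) by (field; lra).
      replace (e2 * Rpower (B * t) th)
        with (p j0 * c2 * c / (4 * K2) * (c * Rpower (B * t) th)) by (unfold e2; field; lra).
      apply Rmult_le_compat_l.
      * left; apply Rdiv_lt_0_compat; [repeat apply Rmult_lt_0_compat; easy|lra].
      * nra.
    + apply Rmult_le_compat_l; [easy|]. apply Rmult_le_compat_l; lra.
Qed.

(** * The uniform local estimate *)

Lemma exists_atom p : maximal_span_one p -> exists j0, 0 < p j0.
Proof. intros H; destruct (exists_other_atom p 0 H) as [k [Hk _]]; now exists k. Qed.

(** For fixed n the mass function is cut to a finite set missing so little mass that n times the
    loss is below eps. Fourier inversion bounds the restricted walk by a constant independent of the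
    cut, and eps is arbitrary. *)
Lemma local_concentration p a (b : nat -> R) (U : R -> R) x0 K th c :
  is_pmf p -> maximal_span_one p ->
  decay_profile p a U x0 K th c ->
  exists C, 0 <= C /\ forall n k, x0 <= b n -> c <= INR n * U (b n) ->
    b n * convpow p n k <= C.
Proof.
  intros Hpm Hspan HD; assert (Hx0 := proj1 HD); assert (Hth := proj1 (proj2 HD)).
  assert (Hp := proj1 Hpm); assert (HPI := PI_RGT_0).
  destruct (exists_atom p Hspan) as [j0 Hj].
  destruct (cos_gap_growth p a b U x0 K th c j0 Hpm Hspan Hj HD)
    as [c' [Hc' Hgrow]].
  destruct (stretched_exp_le c' th Hc' Hth) as [L [HL Hexp]].
  exists L; split; [lra|]; intros n k Hbn HnU.
  destruct (Hgrow n Hbn HnU) as [M HM].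
  assert (Hb : 0 < b n) by lra.
  assert (Hn0 := pos_INR n).
  enough (H : convpow p n k <= L / b n).
  { apply Rle_div_r in H; lra. }
  apply le_epsilon; intros eps Heps.
  destruct Hpm as [_ [Hsum Htot]].
  destruct (summableZ_cv p Hsum (eps / (INR n + 1)) ltac:(apply Rdiv_lt_0_compat; lra))
    as [N HN].
  set (s := Zrange (max N (max M (Z.to_nat (Z.abs j0))))).
  specialize (HN (max N (max M (Z.to_nat (Z.abs j0)))) ltac:(lia)); fold s in HN.
  unfold Rdist in HN; apply Rabs_def2 in HN; rewrite Htot in HN.
  assert (Hs : NoDup s) by apply NoDup_Zrange.
  assert (Hjs : In j0 s) by (apply in_Zrange; lia).
  assert (Hpm : is_pmf p) by easy.
  apply Rle_trans with (1 := convpow_le_fpow p s n k Hpm Hs).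
  apply Rplus_le_compat.
  - apply fpow_le_of_lorentzian; [easy|lra|].
    intros t Ht.
    apply Rle_trans with (1 := inversion_integrand_le_exp p s n k t j0 Hpm Hs Hjs).
    destruct (Rle_lt_dec 1 (b n * t)) as [H1|H1].
    + apply Rle_trans with (2 := Hexp _ H1).
      apply exp_le, Ropp_le_contravar.
      apply HM; [apply incl_Zrange_mono; lia|easy|lra].
    (* For b_n t < 1 the trivial bound 1 is enough, because L >= 2. *)
    + apply Rle_trans with 1.
      * rewrite <- exp_0; apply exp_le.
        assert (0 <= cos_gap p j0 s t)
          by (apply lsum_nonneg; intros i; now apply cos_gap_term_nonneg).
        assert (0 <= INR n * (p j0 * cos_gap p j0 s t))
          by (apply Rmult_le_pos; [easy|apply Rmult_le_pos; lra]).
        lra.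
      * assert (0 <= b n * t) by nra.
        assert (0 <= (b n * t)² <= 1) by (unfold Rsqr; nra).
        apply Rle_div_r; lra.
  - assert (E : eps = eps / (INR n + 1) * (INR n + 1)) by (field; lra).
    assert (0 < eps / (INR n + 1)) by (apply Rdiv_lt_0_compat; lra).
    rewrite E; nra.
Qed.

(** * Tails and truncated moments *)

Lemma trunc2_nonneg p a x : is_pmf p -> 0 <= trunc2 p a x.
Proof.
  intros Hpm; apply sumZ_nonneg; [|now apply trunc2_summable].
  intros k; apply trunc2_term_bounds, Hpm.
Qed.

Lemma trunc2_mono p a x y : is_pmf p -> x <= y -> trunc2 p a x <= trunc2 p a y.
Proof.
  intros Hpm Hxy; apply sumZ_le; [|now apply trunc2_summable].
  intros k; split; [apply trunc2_term_bounds, Hpm|].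
  assert (B := proj1 (trunc2_term_bounds p a y k (proj1 Hpm))).
  destruct (Rle_dec (Rabs (a + IZR k)) x) as [H|H]; [|easy].
  destruct (Rle_dec (Rabs (a + IZR k)) y); lra.
Qed.

(** The profile is V(x)/x^2 with V the truncated second moment. V is comparable to the slowly
    varying h, so doubling x at most doubles V; and B^2 = n h(B) makes n V(B)/B^2 of order 1. *)
Lemma decay_profile_alpha2 p a h : is_pmf p -> slowly_varying h ->
  lim_infty (fun x => h x / trunc2 p a x) 1 ->
  exists U x0 K th c, decay_profile p a U x0 K th c /\
    forall n B, x0 <= B -> Rpower B 2 = INR n * h B -> c <= INR n * U B.
Proof.
  intros Hpm [[M1 H1] Hsv] Hlim.
  destruct (Hsv 2 ltac:(lra) (1 / 8) ltac:(lra)) as [M2 H2].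
  destruct (Hlim (1 / 8) ltac:(lra)) as [M3 H3].
  set (V := trunc2 p a) in *.
  set (x0 := Rmax 1 (Rmax M1 (Rmax M2 M3)) + 1).
  assert (Hx0 : forall x, x0 <= x -> 1 < x /\ M1 < x /\ M2 < x /\ M3 < x).
  { intros x; unfold x0.
    assert (A1 := Rmax_l 1 (Rmax M1 (Rmax M2 M3))).
    assert (A2 := Rmax_r 1 (Rmax M1 (Rmax M2 M3))).
    assert (A3 := Rmax_l M1 (Rmax M2 M3)); assert (A4 := Rmax_r M1 (Rmax M2 M3)).
    assert (A5 := Rmax_l M2 M3); assert (A6 := Rmax_r M2 M3); lra. }
  assert (V0 : forall x, 0 <= V x) by (intros x; now apply trunc2_nonneg).
  assert (HV : forall x, x0 <= x -> 0 < V x /\ 7 / 8 * V x <= h x <= 9 / 8 * V x).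
  { intros x Hx; destruct (Hx0 x Hx) as [_ [_ [_ Hx3]]].
    specialize (H3 x Hx3); specialize (V0 x).
    assert (Vp : 0 < V x).
    (* Division by zero yields 0, so a quotient close to 1 excludes V x = 0. *)
    { destruct V0 as [?|E]; [easy|exfalso].
      rewrite <- E, Rdiv_0_r, Rminus_0_l, Rabs_Ropp, Rabs_R1 in H3; lra. }
    split; [easy|].
    assert (E : h x = h x / V x * V x) by (field; lra).
    apply Rabs_def2 in H3; rewrite E; split; apply Rmult_le_compat_r; lra. }
  assert (HV2 : forall x, x0 <= x -> V (2 * x) <= 2 * V x).
  { intros x Hx; destruct (Hx0 x Hx) as [Hx1 [Hx2 [Hx3 _]]].
    destruct (HV x Hx) as [Vp Vx].
    destruct (HV (2 * x) ltac:(lra)) as [Vp2 Vx2].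
    specialize (H2 x Hx3); apply Rabs_def2 in H2.
    specialize (H1 x Hx2).
    assert (E : h (2 * x) = h (2 * x) / h x * h x) by (field; lra).
    assert (h (2 * x) <= 9 / 8 * h x) by (rewrite E; apply Rmult_le_compat_r; lra).
    lra. }
  (* The exponent is 1 because V(2x) <= 2 V(x) gives 2 V(2x)/(2x)^2 <= V(x)/x^2. *)
  exists (fun x => V x / x ^ 2), x0, 2, 1, (1 / 2).
  assert (X0 : 1 < x0) by now apply Hx0, Rle_refl.
  split; [repeat split; try lra|].
  - intros x Hx; apply Rmult_le_pos; [apply V0|].
    left; apply Rinv_0_lt_compat, pow_lt; lra.
  - intros x Hx; rewrite Rpower_1 by lra.
    specialize (HV2 x Hx).
    replace (2 * (V (2 * x) / (2 * x) ^ 2)) with (V (2 * x) / 2 / x ^ 2) by (field; lra).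
    apply Rmult_le_compat_r; [|lra].
    left; apply Rinv_0_lt_compat, pow_lt; lra.
  - intros x z Hx Hz; specialize (HV2 x (proj1 Hx)).
    assert (Hm : V z <= V (2 * x)) by now apply trunc2_mono.
    replace (2 * (V x / x ^ 2)) with (2 * V x * / x ^ 2) by (field; lra).
    apply Rmult_le_compat; [apply V0| |lra|].
    + left; apply Rinv_0_lt_compat, pow_lt; lra.
    + apply Rinv_le_contravar; [apply pow_lt; lra|]. apply pow_incr; lra.
  - intros x Hx; replace (1 / 2 * x ^ 2 * (V x / x ^ 2)) with (V x / 2) by (field; lra).
    specialize (V0 x); fold V; lra.
  - intros n B HB Hdef.
    destruct (Hx0 B HB) as [B1 [B2 _]]; destruct (HV B HB) as [Vp Vx].
    assert (E : B ^ 2 = INR n * h B).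
    { rewrite <- Hdef; replace 2 with (INR 2) by (simpl; ring).
      rewrite Rpower_pow by lra; easy. }
    assert (Bp : 0 < B ^ 2) by (apply pow_lt; lra).
    replace (INR n * (V B / B ^ 2)) with (INR n * V B / B ^ 2) by (field; lra).
    apply (proj1 (Rle_div_r (1 / 2) _ (B ^ 2) Bp)). rewrite E.
    assert (Hn := pos_INR n).
    replace (1 / 2 * (INR n * h B)) with (INR n * (h B / 2)) by field.
    apply Rmult_le_compat_l; lra.
Qed.

Definition tail2 (p : Z -> R) (a x : R) : R := tail_gt p a x + tail_le p a x.

Lemma tail_gt_summable p a x : is_pmf p ->
  summableZ (fun k => if Rlt_dec x (a + IZR k) then p k else 0).
Proof.
  intros [Hp [Hs _]]; apply summableZ_le with p; [|easy].
  intros k; specialize (Hp k); destruct (Rlt_dec x (a + IZR k)); lra.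
Qed.

Lemma tail_le_summable p a x : is_pmf p ->
  summableZ (fun k => if Rle_dec (a + IZR k) (- x) then p k else 0).
Proof.
  intros [Hp [Hs _]]; apply summableZ_le with p; [|easy].
  intros k; specialize (Hp k); destruct (Rle_dec (a + IZR k) (- x)); lra.
Qed.

Lemma tail2_nonneg p a x : is_pmf p -> 0 <= tail2 p a x.
Proof.
  intros Hpm; assert (Hp := proj1 Hpm); apply Rplus_le_le_0_compat; apply sumZ_nonneg.
  - intros k; destruct (Rlt_dec x (a + IZR k)); [easy|lra].
  - now apply tail_gt_summable.
  - intros k; destruct (Rle_dec (a + IZR k) (- x)); [easy|lra].
  - now apply tail_le_summable.
Qed.

Lemma tail2_antitone p a x y : is_pmf p -> x <= y -> tail2 p a y <= tail2 p a x.
Proof.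
  intros Hpm Hxy; assert (Hp := proj1 Hpm); apply Rplus_le_compat; apply sumZ_le.
  - intros k; specialize (Hp k).
    destruct (Rlt_dec y (a + IZR k)), (Rlt_dec x (a + IZR k)); lra.
  - now apply tail_gt_summable.
  - intros k; specialize (Hp k).
    destruct (Rle_dec (a + IZR k) (- y)), (Rle_dec (a + IZR k) (- x)); lra.
  - now apply tail_le_summable.
Qed.

(** Chebyshev: a point with |z| >= y is either counted in the tail at x, or has |z| <= x and z^2/y^2
    >= 1. *)
Lemma tail2_le_trunc2 p a y x : is_pmf p -> 0 < y ->
  tail2 p a y <= tail2 p a x + trunc2 p a x / y ^ 2.
Proof.
  intros Hpm Hy; assert (Hp := proj1 Hpm).
  assert (Hy2 : 0 < / y ^ 2) by (apply Rinv_0_lt_compat, pow_lt; easy).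
  apply sumZ_plus_bounded.
  - intros k; destruct (Rlt_dec y (a + IZR k)); [easy|lra].
  - intros k; destruct (Rle_dec (a + IZR k) (- y)); [easy|lra].
  - now apply tail_gt_summable.
  - now apply tail_le_summable.
  - intros s Hs.
    set (f1 := fun k => if Rlt_dec x (a + IZR k) then p k else 0).
    set (f2 := fun k => if Rle_dec (a + IZR k) (- x) then p k else 0).
    set (f3 := fun k => if Rle_dec (Rabs (a + IZR k)) x then (a + IZR k) ^ 2 * p k else 0).
    apply Rle_trans with (lsum f1 s + lsum f2 s + / y ^ 2 * lsum f3 s).
    + rewrite <- lsum_scal, <- !lsum_plus; apply lsum_le; intros k _.
      specialize (Hp k); unfold f1, f2, f3; set (z := a + IZR k).
      assert (Q : y <= Rabs z -> p k <= / y ^ 2 * (z ^ 2 * p k)).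
      { intros Hz.
        replace (p k) with (/ y ^ 2 * (y ^ 2 * p k)) at 1 by (field; lra).
        apply Rmult_le_compat_l; [lra|].
        apply Rmult_le_compat_r; [easy|].
        rewrite <- (pow2_abs z); apply pow_incr; lra. }
      assert (Q0 : 0 <= / y ^ 2 * (z ^ 2 * p k)).
      { apply Rmult_le_pos; [lra|]. apply Rmult_le_pos; [apply pow2_ge_0|easy]. }
      revert Q; unfold Rabs; destruct (Rcase_abs z);
      destruct (Rlt_dec y z), (Rle_dec z (- y)), (Rlt_dec x z), (Rle_dec z (- x));
        intros Q; match goal with |- context [Rle_dec ?u x] => destruct (Rle_dec u x) end;
        try lra; try (specialize (Q ltac:(lra)); lra).
    + unfold tail2; apply Rplus_le_compat; [apply Rplus_le_compat|].
      * apply lsum_le_sumZ; [|now apply tail_gt_summable|easy].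
        intros k; unfold f1; destruct (Rlt_dec x (a + IZR k)); [easy|lra].
      * apply lsum_le_sumZ; [|now apply tail_le_summable|easy].
        intros k; unfold f2; destruct (Rle_dec (a + IZR k) (- x)); [easy|lra].
      * unfold Rdiv; rewrite Rmult_comm; apply Rmult_le_compat_r; [lra|].
        apply lsum_le_sumZ; [|now apply trunc2_summable|easy].
        intros k; apply trunc2_term_bounds, Hpm.
Qed.

(** The profile is the two-sided tail T, with x^alpha T(x) close to (c1 + c2) l(x). Only half of the
    exponent alpha is claimed as decay; the spare factor q = 2^(alpha/2) absorbs the slow variation
    of l. *)
Lemma decay_profile_alpha_lt2 p a alpha c1 c2 l h : is_pmf p ->
  0 < alpha -> c1 + c2 > 0 -> slowly_varying l ->
  lim_infty (fun x => Rpower x alpha * tail_gt p a x / l x) c1 ->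
  lim_infty (fun x => Rpower x alpha * tail_le p a x / l x) c2 ->
  lim_infty (fun x => h x / l x) 1 ->
  exists U x0 K th c, decay_profile p a U x0 K th c /\
    forall n B, x0 <= B -> Rpower B alpha = INR n * h B -> c <= INR n * U B.
Proof.
  intros Hpm Ha Hs [[M0 Hl0] Hsv] Hr Hle Hh.
  set (q := Rpower 2 (alpha / 2)).
  assert (Hq : 1 < q).
  { unfold q; rewrite <- (Rpower_O 2) by lra; apply Rpower_lt; lra. }
  assert (Hq2 : Rpower 2 alpha = q * q).
  { unfold q; rewrite <- Rpower_plus; f_equal; field. }
  (* Small enough that (1 + e)^2 <= q (1 - e), which is what the doubling inequality for T
     requires. *)
  set (e := Rmin (1 / 2) ((q - 1) / 8)).
  assert (He : 0 < e /\ e <= 1 / 2 /\ 8 * e <= q - 1).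
  { split; [apply Rmin_glb_lt; lra|].
    split; [apply Rmin_l|]. assert (Q := Rmin_r (1 / 2) ((q - 1) / 8)); fold e in Q; lra. }
  assert (Hqe : (1 + e) * (1 + e) <= q * (1 - e)) by nra.
  set (s := c1 + c2) in *.
  destruct (Hsv 2 ltac:(lra) e ltac:(lra)) as [M1 H1].
  destruct (Hr (s * e / 2) ltac:(nra)) as [M2 H2].
  destruct (Hle (s * e / 2) ltac:(nra)) as [M3 H3].
  destruct (Hh e ltac:(lra)) as [M4 H4].
  set (y0 := Rmax (Rmax 1 M0) (Rmax (Rmax M1 M2) (Rmax M3 M4)) + 1).
  assert (Hy0 : forall x, y0 <= x -> 1 < x /\ M0 < x /\ M1 < x /\ M2 < x /\ M3 < x /\ M4 < x).
  { intros x; unfold y0.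
    assert (A1 := Rmax_l (Rmax 1 M0) (Rmax (Rmax M1 M2) (Rmax M3 M4))).
    assert (A2 := Rmax_r (Rmax 1 M0) (Rmax (Rmax M1 M2) (Rmax M3 M4))).
    assert (A3 := Rmax_l 1 M0); assert (A4 := Rmax_r 1 M0).
    assert (A5 := Rmax_l (Rmax M1 M2) (Rmax M3 M4)).
    assert (A6 := Rmax_r (Rmax M1 M2) (Rmax M3 M4)).
    assert (A7 := Rmax_l M1 M2); assert (A8 := Rmax_r M1 M2).
    assert (A9 := Rmax_l M3 M4); assert (A10 := Rmax_r M3 M4); lra. }
  set (T := tail2 p a).
  assert (HT : forall x, y0 <= x ->
     s * (1 - e) * l x <= Rpower x alpha * T x <= s * (1 + e) * l x).
  { intros x Hx; destruct (Hy0 x Hx) as [_ [X0 [_ [X2 [X3 _]]]]].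
    specialize (H2 x X2); specialize (H3 x X3); specialize (Hl0 x X0).
    apply Rabs_def2 in H2, H3.
    assert (E : Rpower x alpha * T x =
      (Rpower x alpha * tail_gt p a x / l x + Rpower x alpha * tail_le p a x / l x) * l x)
      by (unfold T, tail2; field; lra).
    rewrite E; split; apply Rmult_le_compat_r; unfold s in *; lra. }
  assert (Hdbl : forall x, y0 <= x -> q * T (2 * x) <= T x).
  { intros x Hx; destruct (Hy0 x Hx) as [X1 [X0 [X2 _]]].
    assert (L1 := HT x Hx); assert (L2 := HT (2 * x) ltac:(lra)).
    specialize (Hl0 x X0); specialize (H1 x X2); apply Rabs_def2 in H1.
    assert (E : l (2 * x) = l (2 * x) / l x * l x) by (field; lra).
    assert (L3 : l (2 * x) <= (1 + e) * l x) by (rewrite E; apply Rmult_le_compat_r; lra).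
    rewrite <- Rpower_mult_distr, Hq2 in L2 by lra.
    assert (R1 := Rpower_pos x alpha).
    apply Rmult_le_reg_l with (q * Rpower x alpha); [nra|].
    apply Rle_trans with (s * (1 + e) * ((1 + e) * l x)).
    - apply Rle_trans with (s * (1 + e) * l (2 * x)); [lra|].
      apply Rmult_le_compat_l; [nra|easy].
    - apply Rle_trans with (q * (s * (1 - e) * l x)).
      + replace (s * (1 + e) * ((1 + e) * l x)) with ((s * l x) * ((1 + e) * (1 + e))) by ring.
        replace (q * (s * (1 - e) * l x)) with ((s * l x) * (q * (1 - e))) by ring.
        apply Rmult_le_compat_l; [nra|easy].
      + rewrite (Rmult_assoc q (Rpower x alpha)); apply Rmult_le_compat_l; lra. }
  assert (Y0 : 1 < y0) by now apply Hy0, Rle_refl.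
  assert (T0 : forall x, 0 <= T x) by (intros x; now apply tail2_nonneg).
  (* The first bound serves the comparison with [trunc2]. The second serves n T(B) >= s (1 -
     e)/(3/2) >= s/3. *)
  set (c := Rmin ((q - 1) / 4) (s / 3)).
  assert (Hc : 0 < c /\ c <= (q - 1) / 4 /\ c <= s / 3).
  { split; [apply Rmin_glb_lt; lra|]. split; [apply Rmin_l|apply Rmin_r]. }
  exists T, (2 * y0), 1, (alpha / 2), c.
  split; [repeat split; try lra|].
  - easy.
  - intros x Hx; apply Hdbl; lra.
  - intros x z Hx _; rewrite Rmult_1_l; now apply tail2_antitone.
  - intros x Hx.
    (* Here q T(x) <= T(x/2) <= T(x) + [trunc2]/(x/2)^2, so the second moment dominates (q - 1) T(x)
       x^2/4. Starting at 2 [y0] keeps x/2 in range. *)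
    assert (D := Hdbl (x / 2) ltac:(lra)); replace (2 * (x / 2)) with x in D by field.
    assert (B := tail2_le_trunc2 p a (x / 2) x Hpm ltac:(lra)); fold T in B.
    assert (Hx2 : 0 < x ^ 2) by (apply pow_lt; lra).
    assert (Q : (q - 1) * T x <= trunc2 p a x / (x / 2) ^ 2) by lra.
    apply Rle_div_r in Q; [|apply pow_lt; lra].
    apply Rle_trans with (2 := Q).
    replace ((q - 1) * T x * (x / 2) ^ 2) with ((q - 1) / 4 * (x ^ 2 * T x)) by field.
    rewrite Rmult_assoc; apply Rmult_le_compat_r; [|lra].
    apply Rmult_le_pos; [lra|easy].
  - intros n B HB Hdef.
    destruct (Hy0 B ltac:(lra)) as [B1 [B0 [_ [_ [_ B4]]]]].
    assert (L := proj1 (HT B ltac:(lra))); rewrite Hdef in L.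
    specialize (Hl0 B B0); specialize (H4 B B4); apply Rabs_def2 in H4.
    assert (E : h B = h B / l B * l B) by (field; lra).
    assert (h B <= 3 / 2 * l B) by (rewrite E; apply Rmult_le_compat_r; lra).
    assert (Hn := pos_INR n); specialize (T0 B).
    assert (N : 0 <= INR n * T B) by (apply Rmult_le_pos; easy).
    apply Rle_trans with (s / 3); [lra|].
    apply Rmult_le_reg_r with (l B * (3 / 2)); [lra|].
    apply Rle_trans with (s * (1 - e) * l B).
    + assert (0 <= s * l B) by nra; nra.
    + apply Rle_trans with (1 := L).
      replace (INR n * h B * T B) with (INR n * T B * h B) by ring.
      apply Rmult_le_compat_l; lra.
Qed.

(** * From the local estimate to the covariance bound *)

Lemma bounded_initial_segment (u : nat -> R) N :
  exists B, 0 <= B /\ forall n, (n < N)%nat -> u n <= B.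
Proof.
  induction N as [|N [B [HB IH]]]; [exists 0; split; [lra|lia]|].
  exists (Rmax B (u N)); split; [apply Rle_trans with (1 := HB), Rmax_l|].
  intros n Hn; destruct (Nat.eq_dec n N) as [->|Hne]; [apply Rmax_r|].
  apply Rle_trans with B; [apply IH; lia|apply Rmax_l].
Qed.

(** The explicit power of n/(n - m) restores the powers that [Lfun] divides out. *)
Lemma Lfun_ratio alpha b m n : (1 <= m)%nat -> (m < n)%nat -> b (n - m)%nat > 0 ->
  Rpower (INR n / INR (n - m)) (1 / alpha) * Lfun alpha b n / Lfun alpha b (n - m)
  = b n / b (n - m)%nat.
Proof.
  intros Hm Hmn Hb.
  assert (N1 : 0 < INR n) by (apply lt_0_INR; lia).
  assert (N2 : 0 < INR (n - m)) by (apply lt_0_INR; lia).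
  assert (R1 := Rpower_pos (INR n) (1 / alpha)).
  assert (R2 := Rpower_pos (INR (n - m)) (1 / alpha)).
  assert (E : Rpower (INR n / INR (n - m)) (1 / alpha) * Rpower (INR (n - m)) (1 / alpha)
              = Rpower (INR n) (1 / alpha)).
  { rewrite Rpower_mult_distr; [|now apply Rdiv_lt_0_compat|easy].
    f_equal; field; lra. }
  unfold Lfun; rewrite <- E in R1 |- *.
  assert (R3 := Rpower_pos (INR n / INR (n - m)) (1 / alpha)).
  field; lra.
Qed.

Theorem theorem3p1
  (p : Z -> R) (a : R)
  (Hp_nonneg : forall k, 0 <= p k)
  (Hp_summ : summableZ p)
  (Hp_total : sumZ p = 1)
  (Hspan : maximal_span_one p)
  (alpha c1 c2 : R) (l : R -> R)
  (Halpha : 0 < alpha <= 2) (Halpha1 : alpha <> 1)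
  (Hc1 : 0 <= c1) (Hc2 : 0 <= c2) (Hc12 : c1 + c2 > 0)
  (Hl : slowly_varying l)
  (Htail_r : lim_infty (fun x => Rpower x alpha * tail_gt p a x / l x) c1)
  (Htail_l : lim_infty (fun x => Rpower x alpha * tail_le p a x / l x) c2)
  (Hmean : alpha > 1 -> meanX p a = 0)
  (h : R -> R) (a0 : R)
  (Hh_sv : slowly_varying h)
  (Ha0 : a0 > 0)
  (Hh_cont : forall x, x >= a0 -> continuity_pt h x)
  (Hh_lt2 : alpha < 2 -> lim_infty (fun x => h x / l x) 1)
  (Hh_2 : alpha = 2 -> lim_infty (fun x => h x / trunc2 p a x) 1)
  (b : nat -> R)
  (Hb_pos : forall n, (1 <= n)%nat -> b n > 0)
  (Hb_inf : forall M, exists N, forall n, (n >= N)%nat -> b n > M)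
  (Hb_def : exists N, forall n, (n >= N)%nat -> Rpower (b n) alpha = INR n * h (b n))
  (kk : nat -> Z) (kappa : R)
  (Hkappa : Un_cv (fun n => (INR n * a + IZR (kk n)) / b n) kappa) :
  exists C : R, forall m n : nat, (1 <= m)%nat -> (m < n)%nat ->
    b m * b n *
      Rabs (probJoint p m n (kk m) (kk n) - probSn p m (kk m) * probSn p n (kk n))
    <= C * (Rpower (INR n / INR (n - m)) (1 / alpha) * Lfun alpha b n / Lfun alpha b (n - m) + 1).
Proof.
  assert (Hpm : is_pmf p) by (split; [|split]; assumption).
  assert (HD : exists U x0 K th c, decay_profile p a U x0 K th c /\
    forall n B, x0 <= B -> Rpower B alpha = INR n * h B -> c <= INR n * U B).
  { destruct (Rle_lt_or_eq_dec alpha 2 (proj2 Halpha)) as [Hlt|Heq].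
    - apply (decay_profile_alpha_lt2 p a alpha c1 c2 l h); try tauto; now apply Hh_lt2.
    - rewrite Heq; apply decay_profile_alpha2; [easy|easy|now apply Hh_2]. }
  destruct HD as [U [x0 [K [th [c [HD HnU]]]]]].
  destruct (local_concentration p a b U x0 K th c Hpm Hspan HD) as [C0 [HC0 Hconc]].
  destruct (Hb_inf x0) as [N1 HN1]; destruct Hb_def as [N2 HN2].
  destruct (bounded_initial_segment b (max N1 N2)) as [B [HB Hsmall]].
  set (C1 := C0 + B).
  (* For large n this is the local estimate; for the finitely many other n the probability is at
     most 1 and b_n at most B. *)
  assert (Hloc : forall n k, (1 <= n)%nat -> 0 <= b n * convpow p n k <= C1).
  { intros n k Hn; specialize (Hb_pos n Hn).
    assert (P := convpow_bounds p n k Hpm); split; [nra|].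
    destruct (le_lt_dec (max N1 N2) n) as [Hbig|Hless].
    - assert (X : x0 <= b n) by (left; apply HN1; lia).
      apply Rle_trans with C0; [|unfold C1; lra].
      apply Hconc; [easy|]. apply HnU; [easy|]. apply HN2; lia.
    - specialize (Hsmall n Hless); unfold C1; nra. }
  exists (C1 * C1); intros m n Hm Hmn.
  assert (Bnm : b (n - m)%nat > 0) by (apply Hb_pos; lia).
  assert (Bm := Hb_pos m Hm); assert (Bn : b n > 0) by (apply Hb_pos; lia).
  rewrite Lfun_ratio; [|assumption..].
  unfold probJoint, probSn.
  assert (L1 := Hloc m (kk m) Hm).
  assert (L2 := Hloc (n - m)%nat (kk n - kk m)%Z ltac:(lia)).
  assert (L3 := Hloc n (kk n) ltac:(lia)).
  assert (P1 := convpow_bounds p m (kk m) Hpm).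
  assert (P2 := convpow_bounds p (n - m) (kk n - kk m) Hpm).
  assert (P3 := convpow_bounds p n (kk n) Hpm).
  set (x := convpow p m (kk m)) in *.
  set (y := convpow p (n - m) (kk n - kk m)) in *.
  set (z := convpow p n (kk n)) in *.
  set (r := b n / b (n - m)%nat).
  assert (Hr : 0 < r) by now apply Rdiv_lt_0_compat.
  (* The difference is bounded by the sum of the two products. The first pairs the bounds at m and n
     - m, the ratio r changing b_(n-m) into b_n; the second pairs those at m and n. *)
  apply Rle_trans with (b m * b n * (x * y + x * z)).
  { apply Rmult_le_compat_l; [nra|].
    assert (0 <= x * y) by nra; assert (0 <= x * z) by nra.
    apply Rabs_le; lra. }
  replace (b m * b n * (x * y + x * z))
    with ((b m * x) * (b (n - m)%nat * y) * r + (b m * x) * (b n * z))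
    by (unfold r; field; lra).
  rewrite Rmult_plus_distr_l, Rmult_1_r.
  apply Rplus_le_compat.
  - apply Rmult_le_compat_r; [lra|]. apply Rmult_le_compat; lra.
  - apply Rmult_le_compat; lra.
Qed.
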